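(* Let $n\geq 1$ and let $(\mathcal{T},\mathcal{F})$ be a pair of subcategories of the tube category $\mathbf{T}_n$ of rank $n$. Then $(\mathcal{T},\mathcal{F})$ is a torsion pair in $\mathbf{T}_n$ if and only if, up to $\tau$-actions (that is, after replacing $(\mathcal{T},\mathcal{F})$ by $(\tau^k\mathcal{T},\tau^k\mathcal{F})$ for some integer $k$), one of the following holds: (1) $\mathcal{T}$ is a torsion class in $\langle S_1,S_2,\dots,S_{n-1}\rangle$, and $\mathcal{F}=\mathcal{T}^{\perp}$; (2) $\mathcal{F}$ is a torsionfree class in $\langle S_0,S_1,\dots,S_{n-2}\rangle$, and $\mathcal{T}={}^{\perp}\mathcal{F}$. Here the perpendicular categories are taken in $\mathbf{T}_n$.
   Context: Let $\mathbf{k}$ be an algebraically closed field. $\mathbf{T}_n$ is the category of finite-dimensional nilpotent representations over $\mathbf{k}$ of the cyclic quiver with $n$ vertices. It is a hereditary finite length uniserial abelian category with $n$ simple objects $S_0,\dots,S_{n-1}$ (indices modulo $n$), with Auslander–Reiten translation $\tau$, an autoequivalence with $\tau(S_i)=S_{i-1}$. All subcategories are full and closed under isomorphisms. $\langle\mathcal{S}\rangle$ denotes the smallest subcategory containing $\mathcal{S}$ and closed under extensions and direct summands. For a subcategory $\mathcal{C}$ of $\mathbf{T}_n$, $\mathcal{C}^{\perp}=\{Y\mid\mathrm{Hom}(X,Y)=0\ \forall X\in\mathcal{C}\}$ and ${}^{\perp}\mathcal{C}=\{X\mid\mathrm{Hom}(X,Y)=0\ \forall Y\in\mathcal{C}\}$.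 A torsion pair in an abelian category $\mathcal{A}$ is a pair $(\mathcal{T},\mathcal{F})$ of subcategories with $\mathrm{Hom}(\mathcal{T},\mathcal{F})=0$ such that every $Z\in\mathcal{A}$ admits an exact sequence $0\to X\to Z\to Y\to 0$ with $X\in\mathcal{T}$, $Y\in\mathcal{F}$; then $\mathcal{T}$ is called a torsion class and $\mathcal{F}$ a torsionfree class in $\mathcal{A}$. The subcategories $\langle S_1,\dots,S_{n-1}\rangle$ and $\langle S_0,\dots,S_{n-2}\rangle$ are abelian (they are zero if $n=1$). *)

(* Defs.v *)
From HB Require Import structures.
From mathcomp Require Import all_boot all_order all_algebra.

Set Implicit Arguments.
Unset Strict Implicit.
Unset Printing Implicit Defensive.

Import GRing.Theory.
Local Open Scope ring_scope.

(* The cyclic quiver is oriented i -> i - 1 (mod n), so that Ext^1(S_i, S_j)  *)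
(* is nonzero exactly when j = i - 1, i.e. S_j = tau S_i (Auslander-Reiten    *)
(* formula). There is at most one arrow between two given vertices, a loop    *)
(* if n = 1.                                                                  *)
Definition arrow n (i j : 'I_n) : bool := j == ord_pred i.

Lemma arrow_ordS n (i j : 'I_n) : arrow i j -> arrow (ordS i) (ordS j).
Proof. by rewrite /arrow => /eqP->; rewrite ord_predK ordSK. Qed.

Lemma arrow_ord_pred n (i j : 'I_n) :
  arrow i j -> arrow (ord_pred i) (ord_pred j).
Proof. by rewrite /arrow => /eqP->. Qed.

Section Representations.
Variables (k : fieldType) (n : nat).

Record rep := Rep {
  rep_space :> 'I_n -> vectType k;
  rep_map : forall i j, arrow i j -> 'Hom(rep_space i, rep_space j) }.

(* path_map M m i f : f is the action on M of a path of length m starting     *)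
(* at i.                                                                      *)
Inductive path_map (M : rep) (i : 'I_n) :
    nat -> forall j, 'Hom(M i, M j) -> Prop :=
| PathNil : @path_map M i 0 i \1%VF
| PathCons m j l (f : 'Hom(M i, M j)) (a : arrow j l) :
    path_map m f -> path_map m.+1 (rep_map M a \o f)%VF.

Definition nilpotent_rep (M : rep) : Prop :=
  exists m, forall i j (f : 'Hom(M i, M j)), path_map m f -> f = 0.

Record tube := Tube { tube_rep :> rep; tube_nilpotent : nilpotent_rep tube_rep }.

Record hom (M N : tube) := Hom {
  hom_map :> forall i, 'Hom(M i, N i);
  hom_comm : forall i j (a : arrow i j),
    (rep_map N a \o hom_map i = hom_map j \o rep_map M a)%VF }.

Definition iso (M N : tube) : Prop :=
  exists (f : hom M N) (g : hom N M),
    forall i, (g i \o f i = \1)%VF /\ (f i \o g i = \1)%VF.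

Definition short_exact (X Z Y : tube) (f : hom X Z) (g : hom Z Y) : Prop :=
  forall i, [/\ lker (f i) = 0%VS, limg (f i) = lker (g i)
              & limg (g i) = fullv].

Definition zero_object (M : tube) : Prop := forall i (v : M i), v = 0.

Definition is_biproduct (Z X Y : tube) : Prop :=
  exists (iX : hom X Z) (iY : hom Y Z) (pX : hom Z X) (pY : hom Z Y),
    forall i, [/\ (pX i \o iX i = \1)%VF, (pY i \o iY i = \1)%VF,
                  (pX i \o iY i = 0)%VF, (pY i \o iX i = 0)%VF
                & ((iX i \o pX i) + (iY i \o pY i) = \1)%VF].

Definition direct_summand (X Z : tube) : Prop := exists Y, is_biproduct Z X Y.

(* A full subcategory is given by its class of objects, as a predicate; the   *)
(* type set of mathcomp-classical lives in too small a universe for tube.     *)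
Definition objects := tube -> Prop.

Definition subclass (C D : objects) : Prop := forall M, C M -> D M.
Definition same_class (C D : objects) : Prop := forall M, C M <-> D M.

Definition subcategory (C : objects) : Prop :=
  forall M N, iso M N -> C M -> C N.

Definition extension_closed (C : objects) : Prop :=
  forall (X Z Y : tube) (f : hom X Z) (g : hom Z Y),
    short_exact f g -> C X -> C Y -> C Z.

Definition summand_closed (C : objects) : Prop :=
  forall X Z, direct_summand X Z -> C Z -> C X.

(* The zero objects are required explicitly: this only matters for S empty,   *)
(* where the generated subcategory is zero and not empty.                     *)
Definition generated (S : objects) : objects :=
  fun M => forall C : objects, subcategory C -> subclass zero_object C ->
    extension_closed C -> summand_closed C -> subclass S C -> C M.

Definition hom_zero (X Y : tube) : Prop := forall (f : hom X Y) i, f i = 0.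

Definition right_perp (C : objects) : objects :=
  fun Y => forall X, C X -> hom_zero X Y.

Definition left_perp (C : objects) : objects :=
  fun X => forall Y, C Y -> hom_zero X Y.

(* Torsion pairs in the full subcategory A. Exactness is tested in the tube,  *)
(* which is the exactness of A as soon as A is closed under kernels and       *)
(* cokernels.                                                                 *)
Definition torsion_pair (A T F : objects) : Prop :=
  [/\ subcategory T /\ subcategory F, subclass T A /\ subclass F A,
      forall X Y, T X -> F Y -> hom_zero X Y
    & forall Z, A Z -> exists (X Y : tube) (f : hom X Z) (g : hom Z Y),
        [/\ T X, F Y & short_exact f g]].

Definition whole_tube : objects := fun _ => True.

Definition torsion_class (A T : objects) : Prop :=
  exists F, torsion_pair A T F.

Definition torsionfree_class (A F : objects) : Prop :=
  exists T, torsion_pair A T F.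

Definition simple_rep (i : 'I_n) : rep :=
  @Rep (fun j => 'rV[k]_(j == i)) (fun _ _ _ => 0).

Lemma simple_rep_nilpotent i : nilpotent_rep (simple_rep i).
Proof.
exists 1%N => j l f; move Em: 1%N => m p; case: p Em => // m' j' l' f' a _ _.
by rewrite comp_lfun0l.
Qed.

Definition simple (i : 'I_n) : tube := Tube (simple_rep_nilpotent i).

(* The translation tau is the rotation (tau M)_i = M_(i + 1). *)
Definition tau_rep (M : rep) : rep :=
  @Rep (fun i => M (ordS i)) (fun i j a => rep_map M (arrow_ordS a)).

Definition tauV_rep (M : rep) : rep :=
  @Rep (fun i => M (ord_pred i)) (fun i j a => rep_map M (arrow_ord_pred a)).

Lemma tau_rep_nilpotent (M : tube) : nilpotent_rep (tau_rep M).
Proof.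
have [m Mm] := tube_nilpotent M; exists m => i j f pf.
apply: Mm; elim: {m j f}pf => [|m j l f a _ IH]; first exact: PathNil.
exact: PathCons.
Qed.

Lemma tauV_rep_nilpotent (M : tube) : nilpotent_rep (tauV_rep M).
Proof.
have [m Mm] := tube_nilpotent M; exists m => i j f pf.
apply: Mm; elim: {m j f}pf => [|m j l f a _ IH]; first exact: PathNil.
exact: PathCons.
Qed.

Definition tau (M : tube) : tube := Tube (tau_rep_nilpotent M).
Definition tauV (M : tube) : tube := Tube (tauV_rep_nilpotent M).

Definition tau_pow (e : int) : tube -> tube :=
  match e with Posz m => iter m tau | Negz m => iter m.+1 tauV end.

(* The essential image of C under tau ^ e. *)
Definition tau_image (e : int) (C : objects) : objects :=
  fun M => exists2 N, C N & iso (tau_pow e N) M.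

Lemma tau_simple i : iso (tau (simple i)) (simple (ord_pred i)).
Proof.
have E j : (ordS j == i) = (j == ord_pred i).
  by rewrite -(inj_eq (can_inj (@ord_predK n))) ordSK.
have pidK (b c : bool) (v : 'rV[k]_b) :
    b = c -> v *m (pid_mx 1 : 'M_(b, c)) *m (pid_mx 1 : 'M_(c, b)) = v.
  move=> <-; rewrite -mulmxA mul_pid_mx; case: b v => v.
    by rewrite pid_mx_1 mulmx1.
  by apply/rowP => [[]].
have natf : forall j l (a : arrow j l), (rep_map (simple (ord_pred i)) a \o
    (linfun (mulmxr (pid_mx 1)) : 'Hom(tau (simple i) j, simple (ord_pred i) j))
    = (linfun (mulmxr (pid_mx 1)) : 'Hom(tau (simple i) l, simple (ord_pred i) l))
    \o rep_map (tau (simple i)) a)%VF.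
  by move=> j l a; rewrite comp_lfun0l comp_lfun0r.
have natg : forall j l (a : arrow j l), (rep_map (tau (simple i)) a \o
    (linfun (mulmxr (pid_mx 1)) : 'Hom(simple (ord_pred i) j, tau (simple i) j))
    = (linfun (mulmxr (pid_mx 1)) : 'Hom(simple (ord_pred i) l, tau (simple i) l))
    \o rep_map (simple (ord_pred i)) a)%VF.
  by move=> j l a; rewrite comp_lfun0l comp_lfun0r.
exists (Hom natf), (Hom natg) => j; split; apply/lfunP => v;
  by rewrite comp_lfunE !lfunE /= ?id_lfunE; apply: pidK; rewrite E.
Qed.

End Representations.

Arguments simple k {n} i.
Arguments whole_tube k n : clear implicits.

(* Main.v *)
From HB Require Import structures.
From mathcomp Require Import all_boot all_order all_algebra.
From Stdlib Require Import Classical.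
(* Defs comes last, since vector.v also defines a constant hom. *)
Require Import Defs.

(* Let (T, F) be a torsion pair. The heart of the matter is that some vertex  *)
(* is missing either from the support of all objects of T or from the support *)
(* of all objects of F. Otherwise, for every b, T has an object with a        *)
(* uniserial quotient of socle S_b (take the map to the injective hull of S_b *)
(* given by a nonzero linear form at the vertex b), and for every a, F has an *)
(* object with a uniserial subobject of top S_a (generated by a vector). Take *)
(* such a quotient U for every b, and then a longest one; let S_a be its top  *)
(* and V a subobject as above with top S_a. If V is not longer than U, then V *)
(* is a quotient of U; otherwise the chosen quotient with the same socle as V *)
(* is shorter than V, hence is a subobject of V. Both give a nonzero map from *)
(* T to F. Conversely, starting from the extension 0 -> 0 -> Z -> Z -> 0, the *)
(* subobject in T is enlarged as long as the quotient receives nonzero maps   *)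
(* from T; dually for F.                                                      *)

Set Implicit Arguments.
Unset Strict Implicit.
Unset Printing Implicit Defensive.

Import GRing.Theory.

(** * Morphisms, isomorphisms and exact sequences, computed vertex by vertex *)

Section Tube.
Local Open Scope ring_scope.
Variables (k : fieldType) (n : nat).
Implicit Types (M N X Y Z : tube k n) (C T F : objects k n).

(** The simples other than S_c generate the objects vanishing at c ([generated_avoid]), and powers
    of [tau] move any vertex to any other and preserve torsion pairs ([torsion_pair_tau_image]). So
    everything is about objects vanishing at a vertex.

    In a torsion pair, one of the two classes vanishes at some c ([orthogonal_dichotomy]). Indeed,
    uniserial objects with the same top and the same length are isomorphic, so there is a nonzero
    map from T to F as soon as a uniserial quotient from T and a uniserial subobject from F can be
    cut to match ([hom_of_equal_lengths]). The class vanishing at c is then a torsion or torsionfree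
    class among the objects vanishing at c ([torsion_pair_restrict], [torsionfree_pair_restrict]),
    and each class is the perpendicular of the other ([torsion_pair_perp]).

    Conversely, let (T, G) be a torsion pair among the objects vanishing at c. An extension of a
    quotient of an object of T by an object of T still vanishes at c and has no nonzero map to G, so
    it is in T. Hence in every Z a subobject in T can be enlarged until the quotient is in the right
    perpendicular of T ([torsion_enlarge], [torsion_pair_right_perp]). The case of F is dual. *)

Lemma hom_map_rep M N (f : hom M N) i j (a : arrow i j) v :
  rep_map N a (f i v) = f j (rep_map M a v).
Proof. by rewrite -!comp_lfunE hom_comm. Qed.

(** Naturality is checked on vectors, and the existential hides the record: later arguments see only
    the components. *)
Lemma hom_of_pointwise M N (f : forall i, 'Hom(M i, N i)) :
  (forall i j (a : arrow i j) v,
     rep_map N a (f i v) = f j (rep_map M a v)) ->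
  exists h : hom M N, forall i, h i = f i.
Proof.
move=> fP; have fH i j (a : arrow i j) :
    (rep_map N a \o f i = f j \o rep_map M a)%VF.
  by apply/lfunP => v; rewrite !comp_lfunE fP.
by exists (Hom fH).
Qed.

Lemma hom_comp_ex M N P (f : hom M N) (g : hom N P) :
  exists h : hom M P, forall i, h i = (g i \o f i)%VF.
Proof.
apply: hom_of_pointwise => i j a v.
by rewrite !comp_lfunE !hom_map_rep.
Qed.

Lemma hom_id_ex M : exists h : hom M M, forall i, h i = \1%VF.
Proof. by apply: hom_of_pointwise => i j a v; rewrite !id_lfunE. Qed.

Lemma iso_refl M : iso M M.
Proof.
have [h hE] := hom_id_ex M.
by exists h, h => i; rewrite hE comp_lfun1l.
Qed.

Lemma iso_sym M N : iso M N -> iso N M.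
Proof. by case=> f [g fg]; exists g, f => i; have [] := fg i. Qed.

Lemma iso_trans M N X : iso M N -> iso N X -> iso M X.
Proof.
case=> f [g fg] [f' [g' fg']].
have [h hE] := hom_comp_ex f f'; have [h' hE'] := hom_comp_ex g' g.
exists h, h' => i; rewrite hE hE'; have [gf fgi] := fg i.
have [gf' fgi'] := fg' i; split.
  by rewrite comp_lfunA -(comp_lfunA (g i)) gf' comp_lfun1r.
by rewrite comp_lfunA -(comp_lfunA (f' i)) fgi comp_lfun1r.
Qed.

Lemma iso_of_bijective M N (f : hom M N) :
  (forall i, lker (f i) = 0%VS) -> (forall i, limg (f i) = fullv) -> iso M N.
Proof.
move=> ker_f img_f.
have ker0 i : lker (f i) == 0%VS by rewrite ker_f.
have fK i v : (f i)^-1%VF (f i v) = v by apply: lker0_lfunK.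
have Kf i v : f i ((f i)^-1%VF v) = v by rewrite limg_lfunVK ?img_f ?memvf.
have [i j a v|g gE] := @hom_of_pointwise N M (fun i => (f i)^-1%VF).
  by rewrite -{2}[v]Kf hom_map_rep fK.
by exists f, g => i; rewrite gE; split; apply/lfunP => v;
  rewrite comp_lfunE id_lfunE ?fK ?Kf.
Qed.

Lemma hom_zero_iso M N M' N' :
  iso M M' -> iso N N' -> hom_zero M N -> hom_zero M' N'.
Proof.
case=> f [f' ff'] [g [g' gg']] MN0 h i.
have [u uE] := hom_comp_ex f h; have [w wE] := hom_comp_ex u g'.
have [_ fK] := ff' i; have [_ gK] := gg' i.
have := MN0 w i; rewrite wE uE => /(congr1 (fun z => g i \o z \o f' i)%VF).
rewrite comp_lfun0r comp_lfun0l !comp_lfunA gK comp_lfun1l.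
by rewrite -comp_lfunA fK comp_lfun1r.
Qed.

(** That is, S_i is not a composition factor of M. *)
Definition null_at M i := forall v : M i, v = 0.

Lemma null_at_iso M N i : iso M N -> null_at M i -> null_at N i.
Proof.
case=> f [g fg] M0 v; have [_ fgi] := fg i.
by rewrite -[v]id_lfunE -fgi comp_lfunE [g i v]M0 linear0.
Qed.

Section ShortExact.
Variables (X Z Y : tube k n) (f : hom X Z) (g : hom Z Y).
Hypothesis fg : short_exact f g.

Lemma exact_sub_inj i : injective (f i).
Proof. by have [f0 _ _] := fg i; apply/lker0P; rewrite f0. Qed.

Lemma exact_kerP i v : reflect (g i v = 0) (v \in limg (f i)).
Proof. by have [_ -> _] := fg i; rewrite memv_ker; apply: eqP. Qed.

Lemma exact_comp i v : g i (f i v) = 0.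
Proof. exact/exact_kerP/memv_img/memvf. Qed.

Lemma exact_quo_surj i w : exists v, g i v = w.
Proof.
have [_ _ gT] := fg i; have : w \in limg (g i) by rewrite gT memvf.
by case/memv_imgP=> v _ ->; exists v.
Qed.

Lemma exact_retraction i v : v \in limg (f i) -> f i ((f i)^-1%VF v) = v.
Proof. exact: limg_lfunVK. Qed.

Lemma exact_retractionK i v : (f i)^-1%VF (f i v) = v.
Proof. by apply: lker0_lfunK; have [-> _ _] := fg i. Qed.

Lemma exact_section i w : g i ((g i)^-1%VF w) = w.
Proof. by apply: limg_lfunVK; have [_ _ ->] := fg i; rewrite memvf. Qed.

Lemma null_sub i : null_at Z i -> null_at X i.
Proof. by move=> Z0 v; apply: (@exact_sub_inj i); rewrite [LHS]Z0 [RHS]Z0. Qed.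

Lemma null_quo i : null_at Z i -> null_at Y i.
Proof.
by move=> Z0 w; rewrite -(exact_section w) [(g i)^-1%VF w]Z0 linear0.
Qed.

Lemma null_ext i : null_at X i -> null_at Y i -> null_at Z i.
Proof.
move=> X0 Y0 v; have /memv_imgP [u _ ->] : v \in limg (f i).
  by apply/exact_kerP; apply: Y0.
by rewrite [u]X0 linear0.
Qed.

Lemma exact_sub0_iso : (forall i, f i = 0) -> iso Z Y.
Proof.
move=> f0; apply: (@iso_of_bijective _ _ g) => i; have [_ kg gT] := fg i => //.
by rewrite -kg f0 lim0g.
Qed.

Lemma exact_quo0_iso : (forall i, g i = 0) -> iso X Z.
Proof.
move=> g0; apply: (@iso_of_bijective _ _ f) => i; have [fk fE _] := fg i => //.
by rewrite fE; apply/vspaceP => v; rewrite memv_ker g0 zero_lfunE eqxx memvf.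
Qed.

Lemma short_exact_iso_mid Z' : iso Z Z' ->
  exists (f' : hom X Z') (g' : hom Z' Y), short_exact f' g'.
Proof.
case=> u [w uw].
have [f' fE] := hom_comp_ex f u; have [g' gE] := hom_comp_ex w g.
exists f', g' => i; rewrite fE gE; have [wu uw'] := uw i.
have wuK v : w i (u i v) = v by rewrite -comp_lfunE wu id_lfunE.
have uwK v : u i (w i v) = v by rewrite -comp_lfunE uw' id_lfunE.
split.
- apply/eqP/lker0P => x y; rewrite !comp_lfunE => /(can_inj wuK).
  exact: exact_sub_inj.
- apply/vspaceP => v; rewrite memv_ker comp_lfunE.
  apply/memv_imgP/eqP => [[x _ ->]|/exact_kerP/memv_imgP[x _ wx]].
    by rewrite comp_lfunE wuK exact_comp.
  by exists x; rewrite ?memvf // comp_lfunE -wx uwK.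
- apply/vspaceP => y; rewrite memvf; apply/memv_imgP.
  have [v <-] := exact_quo_surj y; exists (u i v); first exact: memvf.
  by rewrite comp_lfunE wuK.
Qed.
End ShortExact.

End Tube.

(** * Subobjects and quotients from families of subspaces *)

Section Subobjects.
Local Open Scope ring_scope.
Variables (k : fieldType) (n : nat).
Implicit Types (M N X Y Z : tube k n).

Lemma nilpotent_sub M (N : rep k n) (f : forall i, 'Hom(N i, M i)) :
  (forall i, injective (f i)) ->
  (forall i j (a : arrow i j) v,
     rep_map M a (f i v) = f j (rep_map N a v)) -> nilpotent_rep N.
Proof.
move=> f_inj fP; have [m Mm] := tube_nilpotent M.
exists m => i j p pN.
have [q [/Mm q0 qp]] : exists q : 'Hom(M i, M j),
    path_map m q /\ forall v, f j (p v) = q (f i v).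
  elim: {m Mm j p}pN => [|m j l p a _ [q [qM qp]]].
    by exists \1%VF; split=> [|v]; [exact: PathNil | rewrite !id_lfunE].
  exists (rep_map M a \o q)%VF; split=> [|v]; first exact: PathCons.
  by rewrite !comp_lfunE -fP qp.
apply/lfunP => v; apply: (f_inj j).
by rewrite qp q0 !zero_lfunE linear0.
Qed.

Lemma nilpotent_quo M (N : rep k n) (g : forall i, 'Hom(M i, N i)) :
  (forall i w, exists v, g i v = w) ->
  (forall i j (a : arrow i j) v,
     rep_map N a (g i v) = g j (rep_map M a v)) -> nilpotent_rep N.
Proof.
move=> g_surj gP; have [m Mm] := tube_nilpotent M.
exists m => i j p pN.
have [q [/Mm q0 qp]] : exists q : 'Hom(M i, M j),
    path_map m q /\ forall v, p (g i v) = g j (q v).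
  elim: {m Mm j p}pN => [|m j l p a _ [q [qM qp]]].
    by exists \1%VF; split=> [|v]; [exact: PathNil | rewrite !id_lfunE].
  exists (rep_map M a \o q)%VF; split=> [|v]; first exact: PathCons.
  by rewrite !comp_lfunE qp gP.
apply/lfunP => w; have [v <-] := g_surj i w.
by rewrite qp q0 !zero_lfunE linear0.
Qed.

Definition stable Z (U : forall i, {vspace Z i}) :=
  forall i j (a : arrow i j) v, v \in U i -> rep_map Z a v \in U j.

Lemma stable_subobject Z (U : forall i, {vspace Z i}) : stable U ->
  exists X (f : hom X Z),
    (forall i, injective (f i)) /\ forall i, limg (f i) = U i.
Proof.
move=> U_stable.
pose f i : 'Hom(subvs_of (U i), Z i) := linfun vsval.
pose X := @Rep k n (fun i => subvs_of (U i))
  (fun i j a => linfun (vsproj (U j)) \o rep_map Z a \o f i)%VF.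
have fE i w : f i w = vsval w by rewrite lfunE.
have f_inj i : injective (f i) by move=> v w; rewrite !fE; apply: val_inj.
have fP i j (a : arrow i j) v : rep_map Z a (f i v) = f j (rep_map X a v).
  rewrite /= !comp_lfunE !fE lfunE /= vsprojK //.
  by apply: U_stable; apply: subvsP.
have X_nil : nilpotent_rep X := @nilpotent_sub Z X f f_inj fP.
have [h hE] := @hom_of_pointwise _ _ (Tube X_nil) Z f fP.
exists (Tube X_nil), h; split=> i; rewrite hE //.
apply/vspaceP=> v; apply/memv_imgP/idP => [[w _ ->]|Uv].
  by rewrite fE subvsP.
by exists (vsproj (U i) v); rewrite ?memvf // fE vsprojK.
Qed.

(** The quotient is realised inside Z as the image of [c], a projection with kernel U; its inclusion
    [s] is a linear section of [g] that need not commute with the arrows. *)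
Lemma stable_quotient Z (U : forall i, {vspace Z i}) : stable U ->
  exists Y (g : hom Z Y),
    (forall i, lker (g i) = U i) /\ forall i, limg (g i) = fullv.
Proof.
move=> U_stable.
pose c i : 'End(Z i) := \1%VF - projv (U i).
have cE i v : c i v = v - projv (U i) v.
  by rewrite add_lfunE opp_lfunE id_lfunE.
pose g i : 'Hom(Z i, subvs_of (limg (c i))) :=
  (linfun (vsproj (limg (c i))) \o c i)%VF.
pose s i : 'Hom(subvs_of (limg (c i)), Z i) := linfun vsval.
have sE i w : s i w = vsval w by rewrite lfunE.
have sg i v : s i (g i v) = c i v.
  by rewrite sE comp_lfunE lfunE /= vsprojK // memv_img ?memvf.
have g0 i v : (g i v == 0) = (v \in U i).
  rewrite -[LHS](inj_eq val_inj) -[val (g i v)]sE sg cE subr_eq0.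
  apply/eqP/idP => [->|Uv]; first exact: memv_proj.
  by rewrite projv_id.
have gs i w : g i (s i w) = w.
  apply: val_inj; rewrite -![val _]sE sg cE sE.
  have /memv_imgP[u _ ->] := subvsP w.
  by rewrite cE linearB /= projv_proj subrr subr0.
pose Y := @Rep k n (fun i => subvs_of (limg (c i)))
  (fun i j a => g j \o rep_map Z a \o s i)%VF.
have gP i j (a : arrow i j) v : rep_map Y a (g i v) = g j (rep_map Z a v).
  have -> : rep_map Y a (g i v) = g j (rep_map Z a (s i (g i v))).
    by rewrite [LHS]comp_lfunE; rewrite [LHS]comp_lfunE.
  rewrite sg cE; apply/eqP; rewrite -subr_eq0 -linearB g0.
  rewrite -linearB addrAC subrr sub0r.
  by apply: U_stable; rewrite rpredN memv_proj.
have g_surj i w : exists v, g i v = w by exists (s i w).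
have Y_nil : nilpotent_rep Y := @nilpotent_quo Z Y g g_surj gP.
have [h hE] := @hom_of_pointwise _ _ Z (Tube Y_nil) g gP.
exists (Tube Y_nil), h; split=> i; rewrite hE.
  by apply/vspaceP=> v; rewrite memv_ker g0.
apply/vspaceP=> w; rewrite memvf; apply/memv_imgP.
by exists (s i w); rewrite ?memvf ?gs.
Qed.

Lemma stable_exact Z (U : forall i, {vspace Z i}) : stable U ->
  exists X Y (f : hom X Z) (g : hom Z Y),
    short_exact f g /\ forall i, limg (f i) = U i.
Proof.
move=> U_stable.
have [X [f [f_inj fU]]] := stable_subobject U_stable.
have [Y [g [gU g_surj]]] := stable_quotient U_stable.
exists X, Y, f, g; split=> // i; split; rewrite ?fU ?gU ?g_surj //.
by apply/eqP/lker0P.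
Qed.

Definition dim_family Z (U : forall i, {vspace Z i}) := (\sum_i \dim (U i))%N.

Lemma dim_family_lt Z (U W : forall i, {vspace Z i}) i (v : Z i) :
  (forall i, U i <= W i)%VS -> v \in W i -> v \notin U i ->
  (dim_family U < dim_family W)%N.
Proof.
move=> UW Wv Uv; rewrite /dim_family (bigD1 i) // [leqRHS](bigD1 i) //= -addSn.
apply: leq_add; last by apply: leq_sum => j _; apply: dimvS.
rewrite ltn_neqAle dimvS // andbT; apply: contra Uv => /eqP dimUW.
suff /eqP-> : U i == W i by [].
by rewrite eqEdim UW dimUW leqnn.
Qed.

End Subobjects.

(** * Actions of paths; lengths of vectors and of linear forms *)

Section Paths.
Local Open Scope ring_scope.
Variables (k : fieldType) (n : nat).
Implicit Types (M N X Y Z : tube k n) (i j l : 'I_n).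

Lemma arrow_from_ordS j : arrow (ordS j) j.
Proof. by rewrite /arrow ordSK. Qed.

(** Defined for all i and j, so that the path of length 0 needs no proof that its ends agree. *)
Definition vertex_cast M i j : 'Hom(M i, M j) :=
  if i =P j is ReflectT e then ecast z 'Hom(M i, M z) e \1%VF else 0.

Lemma vertex_cast_id M i : vertex_cast M i i = \1%VF.
Proof.
by rewrite /vertex_cast; case: eqP => // e; rewrite (eq_axiomK e).
Qed.

Lemma vertex_cast_neq M i j : i != j -> vertex_cast M i j = 0.
Proof. by rewrite /vertex_cast; case: eqP. Qed.

(* The action of the only candidate for a path of length t from i to j, *)
(* and 0 if this path does not end at j.                                *)
Fixpoint path_action M t i j : 'Hom(M i, M j) :=
  if t is t'.+1 then
    (rep_map M (arrow_from_ordS j) \o path_action M t' i (ordS j))%VF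
  else vertex_cast M i j.

Lemma path_action_end M t i j :
  path_action M t i j <> 0 -> j = iter t (@ord_pred n) i.
Proof.
elim: t j => [|t IH] j /= ij0.
  by case: (eqVneq i j) => // /vertex_cast_neq.
rewrite -(IH (ordS j)) ?ordSK // => p0; case: ij0.
by rewrite p0 comp_lfun0r.
Qed.

Lemma path_action_rcons M t l i j (a : arrow i j) v :
  rep_map M a (path_action M t l i v) = path_action M t.+1 l j v.
Proof.
have ij : i = ordS j by rewrite (eqP a) ord_predK.
subst i; rewrite /= comp_lfunE.
by rewrite (bool_irrelevance a (arrow_from_ordS j)).
Qed.

(** [path_action] grows at the end of the path; this takes an arrow off its beginning. *)
Lemma path_action_cons M t i j l (a : arrow i j) v :
  path_action M t j l (rep_map M a v) = path_action M t.+1 i l v.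
Proof.
elim: t l => [|t IH] l; last first.
  by rewrite /= comp_lfunE IH /= !comp_lfunE.
have ij : i = ordS j by rewrite (eqP a) ord_predK.
subst i; rewrite (bool_irrelevance a (arrow_from_ordS j)).
have [->|lj] /= := eqVneq l j.
  by rewrite comp_lfunE !vertex_cast_id !id_lfunE.
rewrite comp_lfunE !vertex_cast_neq ?(can_eq (@ordSK n)) 1?eq_sym //.
by rewrite !zero_lfunE linear0.
Qed.

(** The second alternative covers an l that is not reached from i after t steps, where the long path
    may still act nontrivially. *)
Lemma path_action_comp M s t i j l v :
  path_action M s l j (path_action M t i l v) = path_action M (t + s) i j v \/
  path_action M s l j (path_action M t i l v) = 0.
Proof.
elim: s j => [|s IH] j.
  rewrite addn0; have [<-|lj] /= := eqVneq l j.
    by rewrite vertex_cast_id id_lfunE; left.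
  by rewrite vertex_cast_neq // zero_lfunE; right.
rewrite addnS /= !comp_lfunE; have [->|->] := IH (ordS j); first by left.
by rewrite linear0; right.
Qed.

Lemma path_action_nilpotent M : exists m, forall i j, path_action M m i j = 0.
Proof.
have [m Mm] := tube_nilpotent M; exists m => i j.
suff [pM|//] : path_map m (path_action M m i j) \/ path_action M m i j = 0.
  exact: Mm pM.
elim: {Mm}m j => [|m IH] j /=.
  have [->|ij] := eqVneq i j; last by rewrite vertex_cast_neq //; right.
  by left; rewrite vertex_cast_id; apply: PathNil.
have [pM|->] := IH (ordS j); first by left; apply: PathCons.
by rewrite comp_lfun0r; right.
Qed.

Lemma nat_last (E : nat -> Prop) m :
  E 0%N -> ~ E m -> exists t, E t /\ ~ E t.+1.
Proof.
move=> E0 Em; apply: NNPP => noE; apply: Em.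
elim: m => // m Em; apply: NNPP => Em1; apply: noE; by exists m.
Qed.

(** The subobject generated by y is uniserial with top S_a; t counts arrows, so its length is t +
    1. *)
Definition element_length M a t (y : M a) :=
  (exists j, path_action M t a j y <> 0) /\
  forall j, path_action M t.+1 a j y = 0.

Lemma element_length_ex M a (y : M a) : y <> 0 ->
  exists t, element_length t y.
Proof.
move=> y0; have [m Mm] := path_action_nilpotent M.
pose E t := exists j, path_action M t a j y <> 0.
have [||t [Et Et1]] := @nat_last E m.
- by exists a; rewrite /= vertex_cast_id id_lfunE.
- by case=> j; rewrite Mm zero_lfunE.
exists t; split=> // j; apply: NNPP => jy0; apply: Et1; by exists j.
Qed.

(** Dually, the quotient by the largest subobject on which phi vanishes is uniserial with socle S_b
    and length t + 1. *)
Definition functional_length M b t (phi : 'Hom(M b, k^o)) :=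
  (exists i, (phi \o path_action M t i b)%VF <> 0) /\
  forall i v, phi (path_action M t.+1 i b v) = 0.

Lemma functional_length_ex M b (phi : 'Hom(M b, k^o)) : phi <> 0 ->
  exists t, functional_length t phi.
Proof.
move=> phi0; have [m Mm] := path_action_nilpotent M.
pose E t := exists i, (phi \o path_action M t i b)%VF <> 0.
have [||t [Et Et1]] := @nat_last E m.
- by exists b; rewrite /= vertex_cast_id comp_lfun1r.
- by case=> i; rewrite Mm comp_lfun0r.
exists t; split=> // i v; apply: NNPP => iv0; apply: Et1; exists i => p0.
by apply: iv0; rewrite -comp_lfunE p0 zero_lfunE.
Qed.

Lemma functional_neq0 (V : vectType k) (v : V) : v <> 0 ->
  exists phi : 'Hom(V, k^o), phi <> 0.
Proof.
move=> v0; apply: NNPP => no_phi; apply: v0.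
rewrite (coord_vbasis (memvf v)) big1 // => i _.
suff -> : coord (vbasis fullv) i v = 0 by rewrite scale0r.
have -> : coord (vbasis fullv) i v =
  (linfun (coord (vbasis fullv) i : V -> k^o) : 'Hom(V, k^o)) v.
  by rewrite lfunE.
suff -> : (linfun (coord (vbasis fullv) i : V -> k^o) : 'Hom(V, k^o)) = 0.
  by rewrite zero_lfunE.
by apply: NNPP => phi0; apply: no_phi; eexists; apply: phi0.
Qed.

End Paths.

(** * Subcategories generated by simple objects *)

Section Generated.
Local Open Scope ring_scope.
Variables (k : fieldType) (n : nat).
Implicit Types (M N X Y Z : tube k n) (i j l : 'I_n).

Lemma linear_hom_ex (V W : vectType k) (f : V -> W) : linear f ->
  exists h : 'Hom(V, W), forall v, h v = f v.
Proof.
move=> f_lin; pose F := GRing.isLinear.Build _ _ _ _ f f_lin.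
pose ff : {linear V -> W} := HB.pack f F.
by exists (linfun ff) => v; rewrite lfunE.
Qed.

Definition total_dim M := (\sum_i \dim {:M i})%N.

Lemma total_dim_quo_lt X Z Y (f : hom X Z) (g : hom Z Y) i (v : Z i) :
  short_exact f g -> v <> 0 -> g i v = 0 -> (total_dim Y < total_dim Z)%N.
Proof.
move=> fg v0 gv0.
have dimE j : (\dim (lker (g j)) + \dim {:Y j} = \dim {:Z j})%N.
  by have := limg_ker_dim (g j) fullv; have [_ _ ->] := fg j; rewrite capfv.
rewrite /total_dim (bigD1 i) // [ltnRHS](bigD1 i) //= -addSn.
apply: leq_add; last by apply: leq_sum => j _; rewrite -dimE leq_addl.
rewrite -dimE -add1n leq_add2r lt0n dimv_eq0; apply/eqP => ker0.
by apply: v0; apply/eqP; rewrite -memv0 -ker0 memv_ker gv0.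
Qed.

(** The last nonzero path out of v lands in the socle. *)
Lemma socle_ex M i (v : M i) : v <> 0 -> exists j (w : M j),
  w <> 0 /\ forall l (a : arrow j l), rep_map M a w = 0.
Proof.
move=> /element_length_ex[t [[j tj0] t1]].
exists j, (path_action M t i j v); split=> // l a.
by rewrite path_action_rcons.
Qed.

Lemma simple_sub_ex M i (w : M i) :
  w <> 0 -> (forall l (a : arrow i l), rep_map M a w = 0) ->
  exists Y (f : hom (simple k i) M) (g : hom M Y),
    short_exact f g /\ g i w = 0.
Proof.
(* The family u is w at i and 0 elsewhere; the arrows kill it, so its span is a copy of S_i. *)
move=> w0 aw0; pose u j := vertex_cast M i j w.
have au0 j l (a : arrow j l) : rep_map M a (u j) = 0.
  rewrite (@path_action_rcons _ _ M 0).
  rewrite -(path_action_cons 0 _ (eqxx _ : arrow i (ord_pred i))).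
  by rewrite aw0 linear0.
have U_stable : stable (fun j => <[u j]>%VS).
  by move=> j l a _ /vlineP[c ->]; rewrite linearZ /= au0 scaler0 mem0v.
have [Y [g [gU g_surj]]] := stable_quotient U_stable.
(* The spaces of the simple are row vectors of length 1 or 0; the sum of the entries reads the
   coordinate in both cases. *)
have f_ex j : exists h : 'Hom(simple k i j, M j),
    forall r, h r = (\sum_c (r : 'rV[k]_(j == i)) 0 c) *: u j.
  apply: linear_hom_ex => c r s; rewrite scalerA -scalerDl mulr_sumr -big_split.
  by congr (_ *: _); apply: eq_bigr => d _; rewrite !mxE.
have [f0 f0E] := fin_all_exists f_ex.
have [j l a r|f fE] := @hom_of_pointwise _ _ (simple k i) M f0.
  rewrite !f0E linearZ /= au0 zero_lfunE scaler0 big1 ?scale0r // => c _.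
  by rewrite mxE.
exists Y, f, g; split; last first.
  apply/eqP; rewrite -memv_ker gU.
  by rewrite -{1}[w]id_lfunE -vertex_cast_id memv_line.
move=> j; rewrite fE gU; split=> //; last first.
  apply/vspaceP=> v; apply/memv_imgP/vlineP => [[r _ ->]|[c ->]].
    by rewrite f0E; eexists.
  exists (const_mx c : 'rV_(j == i)); rewrite ?memvf // f0E /u.
  under eq_bigr => d _ do rewrite mxE.
  rewrite sumr_const card_ord; have [->|ji] // := eqVneq j i.
  by rewrite vertex_cast_neq 1?eq_sym // zero_lfunE !scaler0.
have row0 (b : bool) (r : 'rV[k]_b) : (b -> \sum_c r 0 c = 0) -> r = 0.
  case: b r => r r0; apply/rowP => c; last by case: c.
  by rewrite mxE -(r0 isT) big_ord1 (ord1 c).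
apply/vspaceP => r; rewrite memv_ker memv0 f0E.
apply/eqP/eqP => [/eqP|->]; last first.
  by rewrite big1 ?scale0r // => c _; rewrite mxE.
rewrite scaler_eq0 => /orP ru; apply: row0 => /eqP ji.
case: ru => [/eqP //|]; rewrite /u; subst j.
by rewrite vertex_cast_id id_lfunE => /eqP.
Qed.

Lemma null_at_summand X Z i : direct_summand X Z -> null_at Z i -> null_at X i.
Proof.
case=> Y [f [h [p [q fp]]]] Z0 v; have [pf _ _ _ _] := fp i.
by rewrite -[v]id_lfunE -pf comp_lfunE [f i v]Z0 linear0.
Qed.

(** Vanishing at given vertices is stable under extensions and summands. Conversely, a simple
    subobject is split off by induction on the dimension; its vertex satisfies P because M is
    nonzero there. *)
Lemma generated_simples (P : 'I_n -> Prop) M :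
  generated (fun N => exists i, P i /\ N = simple k i) M <->
  forall i, ~ P i -> null_at M i.
Proof.
split=> [genM|].
  apply: (genM (fun N => forall i, ~ P i -> null_at N i)).
  - by move=> N N' isoN N0 i Pi; apply: null_at_iso isoN (N0 i Pi).
  - by move=> N N0 i _; apply: N0.
  - move=> X Z Y f g fg X0 Y0 i Pi.
    exact: (null_ext fg (X0 i Pi) (Y0 i Pi)).
  - by move=> X Z XZ Z0 i Pi; apply: null_at_summand XZ (Z0 i Pi).
  - move=> _ [j [Pj ->]] i Pi; have ij : i == j = false.
      by apply/eqP => ij; apply: Pi; rewrite ij.
    move=> v; change ('rV[k]_(i == j)) in v.
    by move: v; rewrite /= ij => v; apply/rowP => [[]].
have [d] := ubnP (total_dim M); elim: d M => // d IH M.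
rewrite ltnS => dM M0 C C_iso C_zero C_ext C_sum C_gen.
have [Mz|] := classic (zero_object M); first exact: C_zero.
move=> /not_all_ex_not[i0 /not_all_ex_not[v v0]].
have [i [w [w0 aw0]]] := socle_ex v0.
have [Y [f [g [fg gw0]]]] := simple_sub_ex w0 aw0.
apply: (C_ext _ _ _ _ _ fg).
  apply: C_gen; exists i; split=> //; apply: NNPP => Pi.
  exact/w0/(M0 i Pi).
apply: (IH Y) => //; last by move=> j Pj; apply: (null_quo fg (M0 j Pj)).
exact: leq_trans (total_dim_quo_lt fg w0 gw0) dM.
Qed.

End Generated.

(** * One of two orthogonal classes vanishes at some vertex *)

Section Dichotomy.
Local Open Scope ring_scope.
Variables (k : fieldType) (n : nat).
Implicit Types (M N X Y Z : tube k n) (i j l a b : 'I_n) (T F : objects k n).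

Lemma inj_iter (S : Type) (h : S -> S) m : injective h -> injective (iter m h).
Proof. by move=> h_inj; elim: m => [|m IH] x y //= /h_inj/IH. Qed.

Lemma functional_vanish X b t (phi : 'Hom(X b, k^o)) :
  (forall i v, phi (path_action X t i b v) = 0) ->
  forall s i v, phi (path_action X (t + s) i b v) = 0.
Proof.
move=> phi0; elim=> [|s IH] i v; first by rewrite addn0.
by rewrite addnS -(path_action_cons _ _ (eqxx _ : arrow i (ord_pred i))) IH.
Qed.

(* The map has uniserial image, with top S_a, socle S_b and length m + 1. *)
Lemma hom_of_equal_lengths X Y a b m (phi : 'Hom(X b, k^o)) (y : Y a) :
  (phi \o path_action X m a b)%VF <> 0 ->
  (forall i v, phi (path_action X m.+1 i b v) = 0) ->
  path_action Y m a b y <> 0 ->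
  (forall j, path_action Y m.+1 a j y = 0) -> ~ hom_zero X Y.
Proof.
move=> phi_m phi_m1 y_m y_m1 XY0.
(* With p_t the path of length t, v goes to the sum of phi(p_t v) p_(m-t) y: a map onto the
   uniserial object cut out by phi, followed by the map sending its top to y. *)
have h_ex j : exists h : 'Hom(X j, Y j), forall v, h v =
    \sum_(t < m.+1) phi (path_action X t j b v) *: path_action Y (m - t) a j y.
  apply: linear_hom_ex => c u v; rewrite scaler_sumr -big_split.
  by apply: eq_bigr => t _; rewrite !linearP /= scalerDl scalerA.
have [h0 h0E] := fin_all_exists h_ex.
have [i j e v|h hE] := @hom_of_pointwise _ _ X Y h0.
  (* Naturality is a shift of t by one; the two boundary terms vanish by [y_m1] and [phi_m1]. *)
  rewrite !h0E linear_sum big_ord_recl [RHS]big_ord_recr /=.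
  rewrite subn0 linearZ /= path_action_rcons y_m1 scaler0 add0r.
  rewrite path_action_cons phi_m1 scale0r addr0.
  apply: eq_bigr => t _; rewrite linearZ /= path_action_rcons path_action_cons.
  by rewrite -subSn ?subSS // ltn_ord.
(* On p_m v, every term but t = 0 evaluates phi on a path longer than m. *)
apply: phi_m; apply/lfunP => v; rewrite zero_lfunE comp_lfunE.
have := congr1 (fun u : 'Hom(_, _) => u (path_action X m a b v)) (XY0 h b).
rewrite hE h0E zero_lfunE big_ord_recl big1 => [|t _]; last first.
  have [->|->] := @path_action_comp _ _ X t.+1 m a b b v; last first.
    by rewrite linear0 scale0r.
  by rewrite /bump /= addnS -addSn functional_vanish ?scale0r.
rewrite /= vertex_cast_id id_lfunE subn0 addr0 => /eqP.
by rewrite scaler_eq0 => /orP[/eqP //|/eqP].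
Qed.

(* Some object of T (resp. F) has a uniserial quotient (resp. subobject) *)
(* with top S_a, socle S_b and length t + 1.                             *)
Definition has_quotient T a b t := exists X, T X /\
  exists phi : 'Hom(X b, k^o), (phi \o path_action X t a b)%VF <> 0 /\
    forall i v, phi (path_action X t.+1 i b v) = 0.

Definition has_sub F a b t := exists Y, F Y /\
  exists y : Y a, path_action Y t a b y <> 0 /\
    forall j, path_action Y t.+1 a j y = 0.

Lemma has_quotient_end T a b t : has_quotient T a b t ->
  b = iter t (@ord_pred n) a.
Proof.
case=> X [_ [phi [phi0 _]]]; apply: (@path_action_end _ _ X) => p0.
by apply: phi0; rewrite p0 comp_lfun0r.
Qed.

Lemma has_sub_end F a b t : has_sub F a b t ->
  b = iter t (@ord_pred n) a.
Proof.
case=> Y [_ [y [y0 _]]]; apply: (@path_action_end _ _ Y) => p0.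
by apply: y0; rewrite p0 zero_lfunE.
Qed.

(** Composing phi with the arrow into b removes the socle. *)
Lemma has_quotient_shorten T a b t s : has_quotient T a b (t + s) ->
  exists b', has_quotient T a b' t.
Proof.
elim: s b => [|s IH] b; first by rewrite addn0; exists b.
rewrite addnS => -[X [TX [phi [phi0 phi1]]]]; apply: (IH (ordS b)).
exists X; split=> //; exists (phi \o rep_map X (arrow_from_ordS b))%VF.
split=> [|i v]; first by rewrite -comp_lfunA.
by rewrite -(phi1 i v) comp_lfunE /= !comp_lfunE.
Qed.

(** Replacing y by its image under the arrow out of a removes the top. *)
Lemma has_sub_shorten F a b t s : has_sub F a b (t + s) ->
  exists a', has_sub F a' b t.
Proof.
elim: s a => [|s IH] a; first by rewrite addn0; exists a.
rewrite addnS => -[Y [FY [y [y0 y1]]]]; apply: (IH (ord_pred a)).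
exists Y; split=> //; exists (rep_map Y (eqxx _ : arrow a (ord_pred a)) y).
by split=> [|j]; rewrite path_action_cons.
Qed.

Lemma has_quotient_sub_exclusive T F a b t :
  (forall X Y, T X -> F Y -> hom_zero X Y) ->
  has_quotient T a b t -> has_sub F a b t -> False.
Proof.
move=> TF0 [X [TX [phi [phi0 phi1]]]] [Y [FY [y [y0 y1]]]].
exact: (hom_of_equal_lengths phi0 phi1 y0 y1 (TF0 _ _ TX FY)).
Qed.

Lemma has_quotient_ex T b X (v : X b) : T X -> v <> 0 ->
  exists t a, has_quotient T a b t.
Proof.
move=> TX /functional_neq0[phi /functional_length_ex[t [[a a0] t1]]].
by exists t, a, X; split=> //; exists phi.
Qed.

Lemma has_sub_ex F a Y (y : Y a) : F Y -> y <> 0 ->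
  exists t b, has_sub F a b t.
Proof.
move=> FY /element_length_ex[t [[b b0] t1]].
by exists t, b, Y; split=> //; exists y.
Qed.

Lemma orthogonal_dichotomy T F : (0 < n)%N ->
  (forall X Y, T X -> F Y -> hom_zero X Y) ->
  exists c : 'I_n, (forall X, T X -> null_at X c) \/
                   (forall Y, F Y -> null_at Y c).
Proof.
move=> n_gt0 TF0; apply: NNPP => no_c.
have T_ex b : exists t a, has_quotient T a b t.
  apply: NNPP => noT; apply: no_c; exists b; left=> X TX v.
  by apply: NNPP => v0; apply: noT; apply: has_quotient_ex TX v0.
have F_ex a : exists t b, has_sub F a b t.
  apply: NNPP => noF; apply: no_c; exists a; right=> Y FY v.
  by apply: NNPP => v0; apply: noF; apply: has_sub_ex FY v0.
(* One quotient is chosen for each socle, so a maximum exists even if the lengths in T are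
   unbounded. *)
have [len lenP] := fin_all_exists T_ex.
case: (@arg_maxnP _ (Ordinal n_gt0) predT len isT) => b _ len_max.
have [a Ta] := lenP b; have [t [b2 Fa]] := F_ex a.
have [t_le|t_gt] := leqP t (len b).
  (* The quotient is cut at its socle to the length of the subobject; the tops already agree. *)
  move: (Ta); rewrite -(subnKC t_le) => /has_quotient_shorten[b' Tab'].
  apply: (has_quotient_sub_exclusive TF0 _ Fa).
  by rewrite (has_sub_end Fa) -(has_quotient_end Tab').
(* By maximality the quotient chosen for the socle [b2] is shorter than the subobject, which is cut
   at its top to that length. *)
have [a3 Ta3] := lenP b2.
have len_t : (len b2 <= t)%N by apply: leq_trans (len_max b2 isT) (ltnW t_gt).
move: (Fa); rewrite -(subnKC len_t) => /has_sub_shorten[a' Fa'].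
apply: (has_quotient_sub_exclusive TF0 Ta3).
suff -> : a3 = a' by [].
(* The tops agree because both reach [b2] in equally many steps. *)
have pred_inj := @inj_iter _ _ (len b2) (can_inj (@ord_predK n)).
by apply: pred_inj; rewrite -(has_quotient_end Ta3) -(has_sub_end Fa').
Qed.

End Dichotomy.

(** * Torsion pairs, perpendiculars and restriction to a subcategory *)

Section TorsionPairs.
Local Open Scope ring_scope.
Variables (k : fieldType) (n : nat).
Implicit Types (M N X Y Z : tube k n) (i j c : 'I_n) (A T F : objects k n).

(** The torsionfree quotient of X receives only the zero map, so X is isomorphic to its torsion
    part. *)
Lemma torsion_mem A T F X : torsion_pair A T F -> A X ->
  (forall Y, F Y -> hom_zero X Y) -> T X.
Proof.
case=> -[isoT _] _ _ ex AX XF0; have [X' [Y [f [g [TX' FY fg]]]]] := ex _ AX.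
by apply: isoT TX'; apply: exact_quo0_iso fg _ => i; apply: XF0.
Qed.

Lemma torsionfree_mem A T F Y : torsion_pair A T F -> A Y ->
  (forall X, T X -> hom_zero X Y) -> F Y.
Proof.
case=> -[_ isoF] _ _ ex AY TY0; have [X [Y' [f [g [TX FY' fg]]]]] := ex _ AY.
apply: isoF FY'; apply: iso_sym; apply: exact_sub0_iso fg _ => i; exact: TY0.
Qed.

Lemma torsion_pair_same A A' T T' F F' :
  same_class A A' -> same_class T T' -> same_class F F' ->
  torsion_pair A T F -> torsion_pair A' T' F'.
Proof.
move=> AA TT FF [[isoT isoF] [TA FA] TF0 ex]; split.
- split=> M N MN; first by move/TT=> TM; apply/TT/(isoT M).
  by move/FF=> FM; apply/FF/(isoF M).
- by split=> M; [move/TT/TA/AA | move/FF/FA/AA].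
- by move=> X Y /TT TX /FF FY; apply: TF0.
- move=> Z /AA/ex[X [Y [f [g [/TT TX /FF FY fg]]]]].
  by exists X, Y, f, g.
Qed.

Lemma right_perp_iso T : subcategory (right_perp T).
Proof.
move=> M N MN TM X TX; exact: (hom_zero_iso (iso_refl X) MN (TM X TX)).
Qed.

Lemma left_perp_iso F : subcategory (left_perp F).
Proof.
move=> M N MN FM Y FY; exact: (hom_zero_iso MN (iso_refl Y) (FM Y FY)).
Qed.

Definition avoid c : objects k n := fun M => null_at M c.

Lemma hom_zero_null_l X Y : zero_object X -> hom_zero X Y.
Proof.
by move=> X0 f i; apply/lfunP => v; rewrite [v]X0 !linear0.
Qed.

Lemma hom_zero_null_r X Y : zero_object Y -> hom_zero X Y.
Proof. by move=> Y0 f i; apply/lfunP => v; rewrite [LHS]Y0 [RHS]Y0. Qed.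

Lemma hom_zero_at X Y : hom_zero X Y ->
  forall (f : hom X Y) i (x : X i), f i x = 0.
Proof. by move=> XY0 f i x; rewrite XY0 zero_lfunE. Qed.

Lemma hom_neq0 X Y : ~ hom_zero X Y ->
  exists (h : hom X Y) i (x : X i), h i x <> 0.
Proof.
move=> /not_all_ex_not[h /not_all_ex_not[i hi]]; exists h, i.
apply: NNPP => h0; apply: hi; apply/lfunP => x; rewrite zero_lfunE.
by apply: NNPP => hx; apply: h0; exists x.
Qed.

Lemma sub_zero_ex Z : exists X Y (f : hom X Z) (g : hom Z Y),
  short_exact f g /\ zero_object X.
Proof.
have U_stable : stable (fun i => 0%VS : {vspace Z i}).
  by move=> i j a v; rewrite !memv0 => /eqP->; rewrite linear0.
have [X [Y [f [g [fg fU]]]]] := stable_exact U_stable.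
exists X, Y, f, g; split=> // i x; apply: (exact_sub_inj fg); rewrite linear0.
by apply/eqP; rewrite -memv0 -fU memv_img ?memvf.
Qed.

Lemma quo_zero_ex Z : exists X Y (f : hom X Z) (g : hom Z Y),
  short_exact f g /\ zero_object Y.
Proof.
have U_stable : stable (fun i => fullv : {vspace Z i}).
  by move=> i j a v _; rewrite memvf.
have [X [Y [f [g [fg fU]]]]] := stable_exact U_stable.
exists X, Y, f, g; split=> // i y; have [v <-] := exact_quo_surj fg y.
by apply/(exact_kerP fg); rewrite fU memvf.
Qed.

Lemma dim_family_le Z (U : forall i, {vspace Z i}) :
  (dim_family U <= total_dim Z)%N.
Proof. by apply: leq_sum => i _; rewrite dimvS ?subvf. Qed.

(** * Extending a torsion pair from the objects vanishing at c to the whole tube *)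

Section AvoidingPair.
Variables (c : 'I_n) (T F : objects k n).
Hypothesis TF : torsion_pair (avoid c) T F.

(** The new subobject is the preimage W of the image of h. It vanishes at c, being an extension of a
    quotient of X' by X, and a map from it to F dies on X, then on that quotient; so it is in T. *)
Lemma torsion_enlarge X Z Y (f : hom X Z) (g : hom Z Y) X' (h : hom X' Y) i0
    (x0 : X' i0) :
  short_exact f g -> T X -> T X' -> h i0 x0 <> 0 ->
  exists X1 Y1 (f1 : hom X1 Z) (g1 : hom Z Y1), [/\ short_exact f1 g1, T X1 &
    (dim_family (fun i => limg (f i)) < dim_family (fun i => limg (f1 i)))%N].
Proof.
move=> fg TX TX' hx0; have [_ [TA FA] TF0 _] := TF.
pose W i := ((g i) @^-1: limg (h i))%VS.
have Wh i z x : g i z = h i x -> z \in W i.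
  by move=> gz; rewrite -memv_preim gz memv_img ?memvf.
have Wf i x : f i x \in W i.
  by apply: (Wh _ _ 0); rewrite (exact_comp fg) linear0.
have W_stable : stable W.
  move=> i j a v; rewrite -memv_preim => /memv_imgP[x _ gv].
  by apply: (Wh _ _ (rep_map X' a x)); rewrite -hom_map_rep gv hom_map_rep.
have [X1 [Y1 [f1 [g1 [fg1 f1W]]]]] := stable_exact W_stable.
(* On W, [r] inverts [f1] and commutes with the arrows; [s] is only a linear section of [g]. *)
pose r i := (f1 i)^-1%VF; pose s i := (g i)^-1%VF.
have rK i z : z \in W i -> f1 i (r i z) = z.
  by move=> Wz; rewrite (exact_retraction (f := f1)) ?f1W.
have r_rep i j (a : arrow i j) z : z \in W i ->
    rep_map X1 a (r i z) = r j (rep_map Z a z).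
  by move=> /rK{2}<-; rewrite hom_map_rep /r (exact_retractionK fg1).
have gs i y : g i (s i y) = y by apply: exact_section fg _ _.
have Ws i x : s i (h i x) \in W i by apply: (Wh _ _ x).
exists X1, Y1, f1, g1; split=> //; last first.
  apply: (@dim_family_lt _ _ _ _ _ i0 (s i0 (h i0 x0))).
  - by move=> i; apply/subvP => _ /memv_imgP[x _ ->]; rewrite f1W Wf.
  - by rewrite f1W Ws.
  - by apply/negP => /= /(exact_kerP fg); rewrite gs => /hx0.
apply: (torsion_mem TF) => [w|Y' FY' u].
  apply: (exact_sub_inj fg1); rewrite linear0.
  have : f1 c w \in W c by rewrite -f1W memv_img ?memvf.
  rewrite -memv_preim => /memv_imgP[x _]; rewrite [x](TA _ TX') linear0.
  by move/(exact_kerP fg)/memv_imgP=> [x' _ ->]; rewrite [x'](TA _ TX) linear0.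
have [i j a x|p pE] :=
    @hom_of_pointwise _ _ X Y' (fun i => u i \o r i \o f i)%VF.
  by rewrite /= !comp_lfunE (hom_map_rep u) r_rep ?Wf // (hom_map_rep f).
have urf i x : u i (r i (f i x)) = 0.
  by have := hom_zero_at (TF0 _ _ TX FY') p x; rewrite pE !comp_lfunE.
(* Since u vanishes on X, it factors through [g], and the choice of [s] no longer matters. *)
have ur_ker i z z' : g i z = g i z' -> u i (r i z) = u i (r i z').
  move=> gz; apply/eqP; rewrite -subr_eq0 -!linearB /=.
  have /memv_imgP[x _ ->] : z - z' \in limg (f i).
    by apply/(exact_kerP fg); rewrite linearB /= gz subrr.
  by rewrite urf.
have [i j a x|q qE] :=
    @hom_of_pointwise _ _ X' Y' (fun i => u i \o r i \o s i \o h i)%VF.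
  rewrite /= !comp_lfunE (hom_map_rep u) r_rep ?Ws //; apply: ur_ker.
  by rewrite gs -(hom_map_rep g) gs hom_map_rep.
have ursh i x : u i (r i (s i (h i x))) = 0.
  by have := hom_zero_at (TF0 _ _ TX' FY') q x; rewrite qE !comp_lfunE.
move=> i; apply/lfunP => w; rewrite zero_lfunE.
have : f1 i w \in W i by rewrite -f1W memv_img ?memvf.
rewrite -memv_preim => /memv_imgP[x _ gx].
rewrite -(exact_retractionK fg1 w) -/(r i) -[RHS](ursh i x).
by apply: ur_ker; rewrite gs.
Qed.

(** Enlarging from the zero subobject stops, as dimensions are bounded by that of Z. *)
Lemma torsion_pair_right_perp : torsion_pair (whole_tube k n) T (right_perp T).
Proof.
have [[isoT _] _ _ _] := TF; split=> //.
- by split=> //; apply: right_perp_iso.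
- by move=> X Y TX TY; apply: TY.
move=> Z _; have [X [Y [f [g [fg X0]]]]] := sub_zero_ex Z.
have TX : T X.
  by apply: (torsion_mem TF) => [|Y' _]; [apply: X0 | apply: hom_zero_null_l].
have [d] := ubnP (total_dim Z - dim_family (fun i => limg (f i)))%N.
elim: d X Y f g fg TX {X0} => // d IH X Y f g fg TX dU.
have [TY|] := classic (right_perp T Y); first by exists X, Y, f, g.
move=> /not_all_ex_not[X' nXY].
have [TX' XY] := imply_to_and _ _ nXY.
have [h [i [x hx]]] := hom_neq0 XY.
have [X1 [Y1 [f1 [g1 [fg1 TX1 lt1]]]]] := torsion_enlarge fg TX TX' hx.
apply: (IH _ _ _ _ fg1 TX1); rewrite ltnS in dU; apply: leq_trans dU.
by rewrite ltn_sub2l // (leq_trans lt1) ?dim_family_le.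
Qed.

(** Dual of [torsion_enlarge]: the new subobject is the image K of the kernel of h, and Z/K is an
    extension of Y by a subobject of Y'. A map from T to Z/K dies in Y, hence lands in that
    subobject, and is zero. *)
Lemma torsionfree_shrink X Z Y (f : hom X Z) (g : hom Z Y) Y' (h : hom X Y') i0
    (x0 : X i0) :
  short_exact f g -> F Y -> F Y' -> h i0 x0 <> 0 ->
  exists X1 Y1 (f1 : hom X1 Z) (g1 : hom Z Y1), [/\ short_exact f1 g1, F Y1 &
    (dim_family (fun i => limg (f1 i)) < dim_family (fun i => limg (f i)))%N].
Proof.
move=> fg FY FY' hx0; have [_ [TA FA] TF0 _] := TF.
pose K i := (f i @: lker (h i))%VS.
have KP i z : reflect (exists2 x, h i x = 0 & z = f i x) (z \in K i).
  apply: (iffP memv_imgP) => -[x].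
    by rewrite memv_ker => /eqP hx ->; exists x.
  by move=> hx ->; exists x; rewrite ?memv_ker ?hx.
have K_stable : stable K.
  move=> i j a _ /KP[x hx ->]; apply/KP; exists (rep_map X a x).
    by rewrite -hom_map_rep hx linear0.
  by rewrite hom_map_rep.
have [X1 [Y1 [f1 [g1 [fg1 f1K]]]]] := stable_exact K_stable.
have g1P i z : reflect (g1 i z = 0) (z \in K i).
  by rewrite -f1K; apply: exact_kerP fg1 _ _.
pose r i := (f i)^-1%VF; pose s i := (g1 i)^-1%VF.
have rf i x : r i (f i x) = x by apply: exact_retractionK fg _ _.
have gs i y : g1 i (s i y) = y by apply: exact_section fg1 _ _.
exists X1, Y1, f1, g1; split=> //; last first.
  apply: (@dim_family_lt _ _ _ _ _ i0 (f i0 x0)).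
  - move=> i; rewrite f1K; apply/subvP => _ /KP[x _ ->].
    by rewrite memv_img ?memvf.
  - by rewrite memv_img ?memvf.
  - rewrite f1K; apply/negP => /KP[x hx /(exact_sub_inj fg) x0E].
    by apply: hx0; rewrite x0E.
apply: (torsionfree_mem TF) => [w|X' TX' u].
  have [z <-] := exact_quo_surj fg1 w; apply/g1P/KP.
  have /(exact_kerP fg)/memv_imgP[x _ ->] : g c z = 0 by apply: (FA _ FY).
  by exists x => //; apply: (FA _ FY').
(* The composite of u and [s] is natural only modulo K, which is killed both by [g] and by [r]
   followed by h. *)
have s_rep i j (a : arrow i j) x :
    rep_map Z a (s i (u i x)) - s j (u j (rep_map X' a x)) \in K j.
  apply/g1P; rewrite linearB /= gs -(hom_map_rep g1) gs.
  by rewrite -(hom_map_rep u) subrr.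
have gK i z : z \in K i -> g i z = 0.
  by case/KP=> x _ ->; apply: exact_comp fg _ _.
have [i j a x|p pE] :=
    @hom_of_pointwise _ _ X' Y (fun i => g i \o s i \o u i)%VF.
  rewrite /= !comp_lfunE (hom_map_rep g); apply/eqP.
  by rewrite -subr_eq0 -linearB /= gK ?s_rep.
have su_img i x : exists x', s i (u i x) = f i x'.
  suff /(exact_kerP fg)/memv_imgP[x' _ sx] : g i (s i (u i x)) = 0.
    by exists x'.
  by have := hom_zero_at (TF0 _ _ TX' FY) p x; rewrite pE !comp_lfunE.
have hrK i z : z \in K i -> h i (r i z) = 0 by case/KP=> x hx ->; rewrite rf.
have [i j a x|q qE] :=
    @hom_of_pointwise _ _ X' Y' (fun i => h i \o r i \o s i \o u i)%VF.
  rewrite /= !comp_lfunE (hom_map_rep h); apply/eqP.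
  have -> : rep_map X a (r i (s i (u i x))) = r j (rep_map Z a (s i (u i x))).
    by have [x' ->] := su_img i x; rewrite rf hom_map_rep rf.
  by rewrite -subr_eq0 -!linearB /= hrK ?s_rep.
move=> i; apply/lfunP => x; rewrite zero_lfunE -[LHS]gs; apply/g1P/KP.
have [x' sx] := su_img i x; exists x' => //.
rewrite -[x'](rf i) -sx.
by have := hom_zero_at (TF0 _ _ TX' FY') q x; rewrite qE !comp_lfunE.
Qed.

Lemma torsion_pair_left_perp : torsion_pair (whole_tube k n) (left_perp F) F.
Proof.
have [[_ isoF] _ _ _] := TF; split=> //.
- by split=> //; apply: left_perp_iso.
- by move=> X Y XF FY; apply: XF.
move=> Z _; have [X [Y [f [g [fg Y0]]]]] := quo_zero_ex Z.
have FY : F Y.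
  apply: (torsionfree_mem TF) => [|X' _]; first exact: Y0.
  exact: hom_zero_null_r.
have [d] := ubnP (dim_family (fun i => limg (f i))).
elim: d X Y f g fg FY {Y0} => // d IH X Y f g fg FY dU.
have [XF|] := classic (left_perp F X); first by exists X, Y, f, g.
move=> /not_all_ex_not[Y' nXY].
have [FY' XY] := imply_to_and _ _ nXY.
have [h [i [x hx]]] := hom_neq0 XY.
have [X1 [Y1 [f1 [g1 [fg1 FY1 lt1]]]]] := torsionfree_shrink fg FY FY' hx.
by apply: (IH _ _ _ _ fg1 FY1); rewrite ltnS in dU; apply: leq_trans dU.
Qed.

End AvoidingPair.

(** In the canonical sequence of an object vanishing at c, the quotient vanishes at c as well. *)
Lemma torsion_pair_restrict c T F : torsion_pair (whole_tube k n) T F ->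
  subclass T (avoid c) ->
  torsion_pair (avoid c) T (fun Y => F Y /\ avoid c Y).
Proof.
move=> [[isoT isoF] _ TF0 ex] TA; split.
- split=> // M N MN [FM M0]; split; [exact: isoF FM | exact: null_at_iso M0].
- by split=> // Y [].
- by move=> X Y TX [FY _]; apply: TF0.
move=> Z Z0; have [X [Y [f [g [TX FY fg]]]]] := ex Z I.
exists X, Y, f, g; split=> //; split=> //.
exact: (null_quo fg (Z0 : null_at Z c)).
Qed.

Lemma torsionfree_pair_restrict c T F : torsion_pair (whole_tube k n) T F ->
  subclass F (avoid c) ->
  torsion_pair (avoid c) (fun X => T X /\ avoid c X) F.
Proof.
move=> [[isoT isoF] _ TF0 ex] FA; split.
- split=> // M N MN [TM M0]; split; [exact: isoT TM | exact: null_at_iso M0].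
- by split=> // X [].
- by move=> X Y [TX _] FY; apply: TF0.
move=> Z Z0; have [X [Y [f [g [TX FY fg]]]]] := ex Z I.
exists X, Y, f, g; split=> //; split=> //.
exact: (null_sub fg (Z0 : null_at Z c)).
Qed.

Lemma torsion_pair_perp T F : torsion_pair (whole_tube k n) T F ->
  same_class F (right_perp T) /\ same_class T (left_perp F).
Proof.
move=> TF; have [_ _ TF0 _] := TF; split=> M; split.
- by move=> FM X TX; apply: TF0.
- by move=> TM; apply: (torsionfree_mem TF).
- by move=> TM Y FY; apply: TF0.
- by move=> FM; apply: (torsion_mem TF).
Qed.

End TorsionPairs.

(** * Reindexing of representations along a map of vertices *)

Section Rotation.
Local Open Scope ring_scope.
Variables (k : fieldType) (n : nat) (s : 'I_n -> 'I_n).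
Hypothesis s_arrow : forall i j, arrow i j -> arrow (s i) (s j).
Hypothesis s_nilpotent : forall M : tube k n, nilpotent_rep
  (@Rep k n (fun i => M (s i)) (fun i j a => rep_map M (s_arrow a))).
Implicit Types (M N X Y Z : tube k n).

(** This treats [tau] and [tauV] at once. *)
Definition rotate M := Tube (s_nilpotent M).

Lemma rotate_hom M N (f : hom M N) :
  exists h : hom (rotate M) (rotate N), forall i, h i = f (s i).
Proof.
apply: (@hom_of_pointwise _ _ (rotate M) (rotate N) (fun i => f (s i))).
by move=> i j a v; apply: (hom_map_rep f (s_arrow a)).
Qed.

Lemma rotate_iso M N : iso M N -> iso (rotate M) (rotate N).
Proof.
case=> f [g fg]; have [f' fE] := rotate_hom f; have [g' gE] := rotate_hom g.
by exists f', g' => i; rewrite fE gE; apply: fg.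
Qed.

Lemma rotate_exact X Z Y (f : hom X Z) (g : hom Z Y) : short_exact f g ->
  exists (f' : hom (rotate X) (rotate Z)) (g' : hom (rotate Z) (rotate Y)),
    short_exact f' g'.
Proof.
move=> fg; have [f' fE] := rotate_hom f; have [g' gE] := rotate_hom g.
by exists f', g' => i; rewrite fE gE; apply: fg.
Qed.

End Rotation.

(** * Transport of torsion pairs along powers of [tau] *)

Section Autoequivalences.
Local Open Scope ring_scope.
Variables (k : fieldType) (n : nat).
Implicit Types (M N X Y Z : tube k n) (C T F : objects k n).
Implicit Types Phi Psi : tube k n -> tube k n.

(** Records what the transport of a torsion pair uses; no action on morphisms is chosen. *)
Record exact_functor Phi : Prop := ExactFunctor {
  functor_iso : forall M N, iso M N -> iso (Phi M) (Phi N);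
  functor_hom_zero : forall M N, hom_zero M N -> hom_zero (Phi M) (Phi N);
  functor_exact : forall X Z Y (f : hom X Z) (g : hom Z Y), short_exact f g ->
    exists (f' : hom (Phi X) (Phi Z)) (g' : hom (Phi Z) (Phi Y)),
      short_exact f' g' }.

Definition inverse_up_to_iso Phi Psi := forall M, iso (Psi (Phi M)) M.

Definition autoequivalence Phi Psi :=
  [/\ exact_functor Phi, exact_functor Psi,
      inverse_up_to_iso Phi Psi & inverse_up_to_iso Psi Phi].

Section InverseRotations.
Variables (s t : 'I_n -> 'I_n).
Hypotheses (s_arrow : forall i j, arrow i j -> arrow (s i) (s j))
           (t_arrow : forall i j, arrow i j -> arrow (t i) (t j)).
Hypothesis s_nil : forall M : tube k n, nilpotent_rep
  (@Rep k n (fun i => M (s i)) (fun i j a => rep_map M (s_arrow a))).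
Hypothesis t_nil : forall M : tube k n, nilpotent_rep
  (@Rep k n (fun i => M (t i)) (fun i j a => rep_map M (t_arrow a))).
Hypothesis tK : cancel t s.

(** The vertices s (t i) and i are equal but not convertible, hence the casts; these commute with an
    arrow because both composites are a path of length 1. *)
Lemma rotateK : inverse_up_to_iso (rotate s_nil) (rotate t_nil).
Proof.
move=> M.
have [i j a v|f fE] := @hom_of_pointwise _ _ (rotate t_nil (rotate s_nil M)) M
    (fun i => vertex_cast M (s (t i)) i).
  rewrite (@path_action_rcons _ _ M 0).
  exact/esym/(@path_action_cons _ _ M 0).
have [i j a v|g gE] := @hom_of_pointwise _ _ M (rotate t_nil (rotate s_nil M))
    (fun i => vertex_cast M i (s (t i))).
  by rewrite (@path_action_cons _ _ M 0) (@path_action_rcons _ _ M 0).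
exists f, g => i; rewrite fE gE /= tK.
by rewrite vertex_cast_id comp_lfun1l.
Qed.

(** Rotated back by t, a map f between the rotations becomes a map between copies of M and N; every
    component of f occurs in it, since t is onto. *)
Lemma rotate_hom_zero M N : cancel s t ->
  hom_zero M N -> hom_zero (rotate s_nil M) (rotate s_nil N).
Proof.
move=> sK MN0 f i; have [h hE] := rotate_hom t_nil f.
have h0 := hom_zero_iso (iso_sym (rotateK M)) (iso_sym (rotateK N)) MN0 h.
suff f0 j : j = t (s i) -> f j = 0 by apply: f0; rewrite sK.
by move=> ->; rewrite -hE h0.
Qed.

End InverseRotations.

Lemma tauVK : inverse_up_to_iso (@tauV k n) (@tau k n).
Proof.
exact: (rotateK (@tauV_rep_nilpotent k n) (@tau_rep_nilpotent k n) (@ordSK n)).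
Qed.

Lemma tauK : inverse_up_to_iso (@tau k n) (@tauV k n).
Proof.
exact: (rotateK (@tau_rep_nilpotent k n) (@tauV_rep_nilpotent k n)
         (@ord_predK n)).
Qed.

Lemma tau_exact : exact_functor (@tau k n).
Proof.
split=> [M N|M N|X Z Y f g].
- exact: (rotate_iso (@tau_rep_nilpotent k n)).
- exact: (@rotate_hom_zero _ _ _ _ (@tau_rep_nilpotent k n)
           (@tauV_rep_nilpotent k n) (@ord_predK n) M N (@ordSK n)).
- exact: (rotate_exact (@tau_rep_nilpotent k n)).
Qed.

Lemma tauV_exact : exact_functor (@tauV k n).
Proof.
split=> [M N|M N|X Z Y f g].
- exact: (rotate_iso (@tauV_rep_nilpotent k n)).
- exact: (@rotate_hom_zero _ _ _ _ (@tauV_rep_nilpotent k n)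
           (@tau_rep_nilpotent k n) (@ordSK n) M N (@ord_predK n)).
- exact: (rotate_exact (@tauV_rep_nilpotent k n)).
Qed.

Lemma exact_functor_iter m Phi :
  exact_functor Phi -> exact_functor (iter m Phi).
Proof.
move=> [iP hP eP]; elim: m => [|m [iI hI eI]].
  by split=> // X Z Y f g fg; exists f, g.
split=> [M N /iI/iP //|M N /hI/hP //|X Z Y f g fg].
by have [f' [g' /eP]] := eI _ _ _ _ _ fg.
Qed.

Lemma inverse_up_to_iso_iter m Phi Psi : exact_functor Psi ->
  inverse_up_to_iso Phi Psi -> inverse_up_to_iso (iter m Phi) (iter m Psi).
Proof.
move=> eP PK; elim: m => [|m IH] M; first exact: iso_refl.
rewrite iterSr /=; apply: iso_trans (IH M).
exact: (functor_iso (exact_functor_iter m eP)).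
Qed.

Lemma autoequivalence_iter m Phi Psi :
  autoequivalence Phi Psi -> autoequivalence (iter m Phi) (iter m Psi).
Proof.
case=> eP eQ PQ QP.
split; by [exact: exact_functor_iter | exact: inverse_up_to_iso_iter].
Qed.

Lemma tau_pow_autoequivalence (e : int) :
  exists Psi, autoequivalence (@tau_pow k n e) Psi.
Proof.
have tauP := And4 tau_exact tauV_exact tauK tauVK.
have tauVP := And4 tauV_exact tau_exact tauVK tauK.
by case: e => m; eexists; apply: autoequivalence_iter;
  [exact: tauP | exact: tauVP].
Qed.

Definition functor_image Phi C : objects k n :=
  fun M => exists2 N, C N & iso (Phi N) M.

Lemma functor_image_torsion_pair Phi Psi T F : autoequivalence Phi Psi ->
  torsion_pair (whole_tube k n) T F ->
  torsion_pair (whole_tube k n) (functor_image Phi T) (functor_image Phi F).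
Proof.
move=> [eP eQ _ QP] [_ _ TF0 ex]; split=> //.
- split=> M N MN [M0 CM0 M0M]; exists M0 => //; exact: iso_trans M0M MN.
- move=> X Y [X0 TX0 X0X] [Y0 FY0 Y0Y].
  exact: hom_zero_iso X0X Y0Y (functor_hom_zero eP (TF0 _ _ TX0 FY0)).
move=> Z _; have [X [Y [f [g [TX FY fg]]]]] := ex (Psi Z) I.
have [f' [g' fg']] := functor_exact eP fg.
have [f1 [g1 fg1]] := short_exact_iso_mid fg' (QP Z).
exists (Phi X), (Phi Y), f1, g1; split=> //.
- by exists X => //; apply: iso_refl.
- by exists Y => //; apply: iso_refl.
Qed.

Lemma functor_imageK Phi Psi C : subcategory C -> autoequivalence Phi Psi ->
  same_class (functor_image Psi (functor_image Phi C)) C.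
Proof.
move=> isoC [eP eQ PQ _] M; split=> [[N [L CL LN] NM]|CM].
  apply: isoC CL; apply: iso_trans NM.
  exact: iso_trans (iso_sym (PQ L)) (functor_iso eQ LN).
by exists (Phi M) => //; exists M => //; apply: iso_refl.
Qed.

(** One direction is transport along the power of [tau], the other along its inverse. *)
Lemma torsion_pair_tau_image (e : int) T F :
  subcategory T -> subcategory F ->
  torsion_pair (whole_tube k n) (tau_image e T) (tau_image e F) <->
  torsion_pair (whole_tube k n) T F.
Proof.
move=> isoT isoF; have [Psi ePsi] := tau_pow_autoequivalence e.
split=> [|TF]; last exact: functor_image_torsion_pair ePsi TF.
have ePsiV : autoequivalence Psi (tau_pow e) by case: ePsi.
move=> /(functor_image_torsion_pair ePsiV); apply: torsion_pair_same => //.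
- exact: functor_imageK isoT ePsi.
- exact: functor_imageK isoF ePsi.
Qed.

Lemma null_at_iter_tau m M j :
  null_at M (iter m (@ordS n) j) -> null_at (iter m (@tau k n) M) j.
Proof.
elim: m j => [|m IH] j //; rewrite iterSr => M0 v; exact: (IH (ordS j) M0 v).
Qed.

Lemma tau_image_avoid m C j : subclass C (avoid (iter m (@ordS n) j)) ->
  subclass (tau_image (Posz m) C) (avoid j).
Proof.
move=> CA M [N CN NM]; apply: null_at_iso NM _.
exact: null_at_iter_tau (CA _ CN).
Qed.

Lemma iter_ordS_transitive (i j : 'I_n) : exists m, iter m (@ordS n) i = j.
Proof.
have val_iter m : val (iter m (@ordS n) i) = ((i + m) %% n)%N.
  elim: m => [|m IH]; first by rewrite addn0 modn_small.
  by rewrite iterS /= IH -addn1 modnDml addn1 addnS.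
(* From i, n - i steps lead to vertex 0, and j more lead to j. *)
exists (n - i + j)%N; apply: val_inj; rewrite val_iter addnA subnKC 1?ltnW //.
by rewrite modnDl modn_small.
Qed.

Lemma generated_avoid c (m : nat) : val c = m ->
  same_class (generated (fun M => exists i, val i <> m /\ M = simple k i))
             (avoid c).
Proof.
move=> cm M; split=> [/generated_simples M0|M0]; first by apply: M0; rewrite cm.
apply/generated_simples => i /NNPP im.
by suff -> : i = c by []; apply: val_inj; rewrite cm.
Qed.

Lemma torsion_class_same A A' T : same_class A A' ->
  torsion_class A T -> torsion_class A' T.
Proof. by move=> AA [F TF]; exists F; apply: torsion_pair_same TF. Qed.

Lemma torsionfree_class_same A A' F : same_class A A' ->
  torsionfree_class A F -> torsionfree_class A' F.
Proof. by move=> AA [T TF]; exists T; apply: torsion_pair_same TF. Qed.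

End Autoequivalences.

(** * The classification up to rotation *)

Theorem theorem4p13 (k : closedFieldType) (n : nat) (hn : (1 <= n)%N)
    (T F : objects k n) (hT : subcategory T) (hF : subcategory F) :
  torsion_pair (whole_tube k n) T F <->
  exists e : int,
    (torsion_class
       (generated (fun M => exists i : 'I_n, val i <> 0%N /\ M = simple k i))
       (tau_image e T)
     /\ same_class (tau_image e F) (right_perp (tau_image e T)))
    \/
    (torsionfree_class
       (generated (fun M => exists i : 'I_n, val i <> n.-1 /\ M = simple k i))
       (tau_image e F)
     /\ same_class (tau_image e T) (left_perp (tau_image e F))).
Proof.
case: n hn T F hT hF => // n _ T F isoT isoF.
have gen0 := @generated_avoid k n.+1 ord0 0 erefl.
have genn := @generated_avoid k n.+1 ord_max n erefl.
split=> [TF|[e [[[F' TF] FE]|[[T' TF] TE]]]].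
- have [_ _ TF0 _] := TF.
  have [c [TA|FA]] := orthogonal_dichotomy (ltn0Sn n) TF0.
    (* The m-th power of [tau] puts the space at c on vertex 0, whose simple is left out in the
       first case. *)
    have [m mc] := iter_ordS_transitive ord0 c; exists (Posz m); left.
    have TFe := (torsion_pair_tau_image (Posz m) isoT isoF).2 TF.
    split; last by have [] := torsion_pair_perp TFe.
    apply: torsion_class_same (fun M => iff_sym (gen0 M)) _.
    eexists; apply: torsion_pair_restrict TFe _.
    by apply: tau_image_avoid; rewrite mc.
  (* Here c is rotated to the last vertex, whose simple is left out in the second case. *)
  have [m mc] := iter_ordS_transitive ord_max c; exists (Posz m); right.
  have TFe := (torsion_pair_tau_image (Posz m) isoT isoF).2 TF.
  split; last by have [] := torsion_pair_perp TFe.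
  apply: torsionfree_class_same (fun M => iff_sym (genn M)) _.
  eexists; apply: torsionfree_pair_restrict TFe _.
  by apply: tau_image_avoid; rewrite mc.
- apply/(torsion_pair_tau_image e isoT isoF).
  (* [F'] lies inside the subcategory; in the whole tube the right perpendicular takes its place. *)
  have TFc :=
    torsion_pair_same gen0 (fun M => iff_refl _) (fun M => iff_refl _) TF.
  apply: torsion_pair_same (torsion_pair_right_perp TFc) => // M.
  exact: iff_sym (FE M).
- apply/(torsion_pair_tau_image e isoT isoF).
  have TFc :=
    torsion_pair_same genn (fun M => iff_refl _) (fun M => iff_refl _) TF.
  apply: torsion_pair_same (torsion_pair_left_perp TFc) => // M.
  exact: iff_sym (TE M).
Qed.
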